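(* Let $(X,x)$ be a filtered pointed diffeological space. Then the internal tangent space $T_x(X)$, equipped with the sub-diffeology from $T^H X$ or with the one from $T^{dvs} X$, is a fine diffeological vector space.
   Context: A diffeological space is a set $X$ with, for each $n \ge 0$ and each open $U \subseteq \mathbb{R}^n$, a specified set of functions $U \to X$ called plots, such that: every constant function $U\to X$ is a plot; if $U \to X$ is a plot and $V \to U$ is a smooth map between open subsets of Euclidean spaces, the composite $V \to X$ is a plot; and a function $U \to X$ whose restriction to each member of some open cover of $U$ is a plot is itself a plot. A function $f : X \to Y$ is smooth if $f \circ p$ is a plot of $Y$ for every plot $p$ of $X$. A subset $A \subseteq X$ carries the sub-diffeology (plots are the functions $U \to A$ whose composite to $X$ is a plot); products and pullbacks carry the product diffeology and its sub-diffeology. A pointed plot $p : (U,0) \to (X,x)$ is a plot $p:U\to X$ where $U$ is a connected open neighbourhood of $0$ in some $\mathbb{R}^n$ and $p(0) = x$. The germ category $\mathcal{G}(X,x)$ has the pointed plots as objects; a morphism from $p : (U,0)\to (X,x)$ to $q : (V,0) \to (X,x)$ is the germ at $0$ of a smooth map $f : W \to V$, with $W$ an open neighbourhood of $0$ in $U$, $f(0)=0$ and $p|_W = q \circ f$. The internal tangent space $T_x(X)$ is the colimit, in real vector spaces, of the functor $\mathcal{G}(X,x) \to \mathrm{Vect}$ sending $p : (U,0) \to (X,x)$ to $T_0(U)$ and a germ $f$ to its derivative at $0$. A category $\mathcal{C}$ is filtered if it is non-empty, any two objects $C, D$ admit morphisms $C \to E$ and $D \to E$ to a common object $E$, and for any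 parallel morphisms $f,g : C \to D$ there is a morphism $h : D \to E$ with $h\circ f = h \circ g$. A pointed diffeological space $(X,x)$ is filtered if $\mathcal{G}(X,x)$ is filtered. Let $TX = \coprod_{x \in X} T_x(X)$ with projection to $X$. For a plot $p : U \to X$, let $Tp : TU \to TX$ send $v \in T_u U$ to the element of $T_{p(u)}(X)$ represented by $v$ at the pointed plot $w \mapsto p(u+w)$ (defined near $0$). $T^H X$ (Hector's diffeology) is $TX$ with the smallest diffeology making all $Tp$ smooth; its plots are the functions that locally are constant or of the form $Tp \circ f$ with $f : U' \to TU$ smooth. $T^{dvs} X$ is $TX$ with the smallest diffeology containing Hector's diffeology and making $TX$ a diffeological vector space over $X$, i.e. such that the projection to $X$, the fiberwise addition $TX \times_X TX \to TX$ and the scalar multiplication $TX \times \mathbb{R} \to TX$ are smooth. A diffeological vector space is a real vector space with a diffeology for which addition and scalar multiplication are smooth. The fine diffeology on a vector space $V$ is the smallest diffeology on $V$ making it a diffeological vector space; a diffeological vector space is fine if its diffeology is the fine one. *)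

(* Defs.v *)
From HB Require Import structures.
From mathcomp Require Import all_boot all_order all_algebra.
From mathcomp Require Import all_classical all_reals all_analysis.

Set Implicit Arguments.
Unset Strict Implicit.
Unset Printing Implicit Defensive.
Import Order.TTheory GRing.Theory Num.Theory.
Import numFieldNormedType.Exports.

Local Open Scope classical_set_scope.
Local Open Scope ring_scope.
Local Open Scope quotient_scope.

Section Smooth.
Context {R : realType}.
Implicit Types V W : normedModType R.

(* Meaningful for U open only: 'd f x depends on f in a neighbourhood of x. *)
Fixpoint Ck V W (k : nat) (U : set V) (f : V -> W) : Prop :=
  if k is k'.+1 then
    (forall x, U x -> differentiable f x) /\
    forall v, Ck k' U (fun x => 'd f x v)
  else forall x, U x -> {for x, continuous f}.

Definition smooth_on V W (U : set V) (f : V -> W) : Prop :=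
  forall k, Ck k U f.

Lemma near_eq_diff V W (f g : V -> W) (x : V) :
  (\near x, f x = g x) -> differentiable f x ->
  differentiable g x /\ 'd g x = 'd f x :> (V -> W).
Proof.
move=> fg df; have fgx : f x = g x by exact: nbhs_singleton fg.
move: (df) => /diff_locallyP[cdf Hf].
have Hg : g \o shift x = cst (g x) + 'd f x +o_ 0 id.
  apply/eqaddoP => e e0.
  move/eqaddoP : Hf => /(_ e e0) Hf.
  have fg0 : \forall y \near 0, f (y + x) = g (y + x).
    by move: fg; rewrite (near_shift 0) /= subr0.
  near=> y.
  have -> : (g \o shift x - (cst (g x) + 'd f x)) y
    = (f \o shift x - (cst (f x) + 'd f x)) y.
    rewrite /GRing.add /GRing.opp /= fgx; congr (_ - _).
    by apply/esym; near: y.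
  near: y; exact: Hf.
have E : 'd g x = 'd f x :> (V -> W) by exact: diff_unique.
split; last exact: E.
by apply/diff_locallyP; rewrite E; split; [exact: cdf|exact: Hg].
Unshelve. all: by end_near. Qed.

Lemma Ck_eq V W k (U : set V) (f g : V -> W) : open U ->
  (forall x, U x -> f x = g x) -> Ck k U f -> Ck k U g.
Proof.
move=> oU; elim: k f g => [|k IH] f g fg /=.
  move=> cf x Ux.
  have gfx : {near x, f =1 g}.
    by apply: filterS (open_nbhs_nbhs (conj oU Ux)) => y /fg.
  have := cf x Ux; rewrite /prop_for /continuous_at -(fg _ Ux).
  by apply: cvg_trans; apply: near_eq_cvg.
have fgx x : U x -> \near x, f x = g x.
  by move=> Ux; apply: filterS (open_nbhs_nbhs (conj oU Ux)) => y /fg.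
move=> [df dfk]; split.
  by move=> x Ux; have [] := near_eq_diff (fgx _ Ux) (df _ Ux).
move=> v; apply: IH (dfk v) => x Ux.
by have [_ ->] := near_eq_diff (fgx _ Ux) (df _ Ux).
Qed.

Lemma CkS V W k (U : set V) (f : V -> W) : Ck k.+1 U f -> Ck k U f.
Proof.
elim: k f => [|k IH] f [df dfk].
  by move=> x Ux; apply: differentiable_continuous; exact: df.
by split=> // v; apply: IH; exact: dfk.
Qed.

Lemma Ck_sub V W k (U U' : set V) (f : V -> W) :
  U' `<=` U -> Ck k U f -> Ck k U' f.
Proof.
move=> UU'; elim: k f => [|k IH] f /=; first by move=> cf x /UU'; exact: cf.
by move=> [df dfk]; split=> [x /UU'|v]; [exact: df|exact: IH].
Qed.

Lemma Ck_bigcup V W k I (P : set I) (U : I -> set V) (f : V -> W) :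
  (forall i, P i -> Ck k (U i) f) -> Ck k (\bigcup_(i in P) U i) f.
Proof.
elim: k f => [|k IH] f H /=; first by move=> x [i Pi Ux]; exact: (H i Pi).
split=> [x [i Pi Ux]|v]; first by have [df _] := H i Pi; exact: df.
by apply: IH => i Pi; have [_] := H i Pi; exact.
Qed.

Lemma Ck_cst V W k (U : set V) (c : W) : open U -> Ck k U (fun=> c).
Proof.
move=> oU; elim: k c => [|k IH] c /=; first by move=> x _; exact: cst_continuous.
split=> [x _|v]; first exact: differentiable_cst.
by apply: Ck_eq (IH 0) => // x _; rewrite diff_cst.
Qed.

Lemma Ck_id V k (U : set V) : open U -> Ck k U (@idfun V).
Proof.
move=> oU; case: k => [|k] /=; first by move=> x _; exact: cvg_id.
split=> [x _|v]; first by apply: ex_diff.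
by apply: (@Ck_eq _ _ _ _ (fun=> v)) (Ck_cst _ _ oU) => // x _; rewrite diff_val.
Qed.

Lemma CkD V W k (U : set V) (f g : V -> W) : open U ->
  Ck k U f -> Ck k U g -> Ck k U (fun x => f x + g x).
Proof.
move=> oU; elim: k f g => [|k IH] f g.
  by move=> cf cg x Ux; apply: cvgD; [exact: cf|exact: cg].
move=> [df dfk] [dg dgk]; split=> [x Ux|v].
  by apply: differentiableD; [exact: df|exact: dg].
apply: Ck_eq (IH _ _ (dfk v) (dgk v)) => // x Ux.
by rewrite -[fun x => f x + g x]/(f + g) diffD//; [exact: df|exact: dg].
Qed.

Lemma Ck_sum V W k (U : set V) n (f : 'I_n -> V -> W) : open U ->
  (forall i, Ck k U (f i)) -> Ck k U (fun x => \sum_(i < n) f i x).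
Proof.
move=> oU; elim: n f => [|n IH] f H.
  by apply: Ck_eq (Ck_cst k 0 oU) => // x _; rewrite big_ord0.
apply: (@Ck_eq _ _ _ _ (fun x => f ord0 x + \sum_(i < n) f (lift ord0 i) x)) => //.
  by move=> x _; rewrite big_ord_recl.
by apply: CkD => //; exact: IH.
Qed.

Lemma scaler_is_bilinear W :
  bilinear_for
    (GRing.Scale.Law.clone _ _ *:%R _) (GRing.Scale.Law.clone _ _ *:%R _)
    (@GRing.scale R W : R^o -> W -> W).
Proof.
split=> [u a x y|u a x y] /=; first by rewrite scalerDl scalerA.
by rewrite scalerDr !scalerA mulrC.
Qed.

Lemma diff_scale V W (r : V -> R^o) (g : V -> W) (x : V) :
  differentiable r x -> differentiable g x ->
  differentiable (fun y => (r y : R) *: g y) x /\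
  'd (fun y => (r y : R) *: g y) x
    = (fun v => (r x : R) *: 'd g x v + ('d r x v : R) *: g x) :> (V -> W).
Proof.
move=> dr dg.
pose bM := bilinear_isBilinear.Build R R^o W W _ _ _ (@scaler_is_bilinear W).
pose b : {bilinear R^o -> W -> W} := HB.pack (@GRing.scale R W : R^o -> W -> W) bM.
have cb : continuous (fun p : R^o * W => b p.1 p.2) by exact: scale_continuous.
have dp : differentiable (fun y => (r y, g y)) x by exact: differentiable_pair.
have -> : (fun y => (r y : R) *: g y)
  = (fun p : R^o * W => b p.1 p.2) \o (fun y => (r y, g y)) by [].
split; first by apply: differentiable_comp => //; exact: differentiable_bilin.
rewrite diff_comp//; last exact: differentiable_bilin.
by rewrite diff_bilin// diff_pair.
Qed.

Lemma Ck_scale V W k (U : set V) (r : V -> R^o) (g : V -> W) : open U ->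
  Ck k U r -> Ck k U g -> Ck k U (fun x => (r x : R) *: g x).
Proof.
move=> oU; elim: k r g => [|k IH] r g.
  by move=> cr cg x Ux; apply: cvgZ; [exact: cr|exact: cg].
move=> kr kg; have [dr drk] := kr; have [dg dgk] := kg; split=> [x Ux|v].
  by have [] := diff_scale (dr _ Ux) (dg _ Ux).
apply: (@Ck_eq _ _ _ _
  (fun x => (r x : R) *: 'd g x v + ('d r x v : R) *: g x)) => //.
  by move=> x Ux; have [_ ->] := diff_scale (dr _ Ux) (dg _ Ux).
by apply: CkD => //; apply: IH; do ?[exact: CkS kr | exact: CkS kg
  | exact: drk | exact: dgk].
Qed.

Lemma diff_coord V m (f : V -> 'rV[R]_m) (i : 'I_m) (x : V) :
  differentiable f x ->
  differentiable (fun y => f y ord0 i : R^o) x /\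
  'd (fun y => f y ord0 i : R^o) x = (fun v => 'd f x v ord0 i) :> (V -> R^o).
Proof.
move=> df.
pose c (N : 'rV[R]_m) : R^o := N ord0 i.
have lc : linear c by move=> a u v; rewrite /c !mxE.
pose cM := GRing.isLinear.Build _ _ _ _ _ lc.
pose cL : {linear 'rV[R]_m -> R^o} := HB.pack c cM.
have cc : continuous cL by exact: coord_continuous.
have dc y : differentiable cL y by exact: linear_differentiable.
have -> : (fun y => f y ord0 i : R^o) = cL \o f by [].
by split; [exact: differentiable_comp|rewrite diff_comp// diff_lin].
Qed.

Lemma Ck_coord V m k (U : set V) (f : V -> 'rV[R]_m) (i : 'I_m) : open U ->
  Ck k U f -> Ck k U (fun y => f y ord0 i : R^o).
Proof.
move=> oU; elim: k f => [|k IH] f.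
  move=> cf x Ux.
  by apply: (@continuous_comp _ _ _ f (fun N : 'rV[R]_m => N ord0 i));
    [exact: cf|exact: coord_continuous].
move=> [df dfk]; split=> [x Ux|v]; first by have [] := diff_coord i (df _ Ux).
apply: (@Ck_eq _ _ _ _ (fun x => 'd f x v ord0 i : R^o)) => //.
  by move=> x Ux; have [_ ->] := diff_coord i (df _ Ux).
by apply: IH; exact: dfk.
Qed.

Lemma Ck_comp V W m k (U : set V) (U' : set 'rV[R]_m)
    (f : V -> 'rV[R]_m) (g : 'rV[R]_m -> W) : open U ->
  (forall x, U x -> U' (f x)) ->
  Ck k U f -> Ck k U' g -> Ck k U (g \o f).
Proof.
move=> oU fU; elim: k f g fU => [|k IH] f g fU.
  by move=> cf cg x Ux; apply: continuous_comp; [exact: cf|exact/cg/fU].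
move=> kf; have [df dfk] := kf; move=> [dg dgk]; split=> [x Ux|v].
  by apply: differentiable_comp; [exact: df|exact/dg/fU].
apply: (@Ck_eq _ _ _ _ (fun x => \sum_(i < m)
    ('d f x v ord0 i : R) *: 'd g (f x) (delta_mx ord0 i : 'rV[R]_m))) => //.
  move=> x Ux; rewrite [in RHS]diff_comp; [|exact: df|exact/dg/fU].
  rewrite /= [in RHS](row_sum_delta ('d f x v)) linear_sum.
  by apply: eq_bigr => i _; rewrite linearZ.
apply: Ck_sum => // i; apply: Ck_scale => //; 
  first exact: (Ck_coord _ oU (dfk v)).
exact: (IH f (fun y => 'd g y (delta_mx ord0 i : 'rV[R]_m)) fU (CkS kf)
          (dgk _)).
Qed.

Lemma smooth_comp V W m (U : set V) (U' : set 'rV[R]_m)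
    (f : V -> 'rV[R]_m) (g : 'rV[R]_m -> W) : open U ->
  (forall x, U x -> U' (f x)) ->
  smooth_on U f -> smooth_on U' g -> smooth_on U (g \o f).
Proof. by move=> oU fU sf sg k; exact: Ck_comp (sf k) (sg k). Qed.

Lemma smooth_id V (U : set V) : open U -> smooth_on U (@idfun V).
Proof. by move=> oU k; exact: Ck_id. Qed.

Lemma smooth_shift V (U : set V) (u : V) : open U ->
  smooth_on U (fun w => u + w).
Proof. by move=> oU k; apply: CkD => //; [exact: Ck_cst|exact: Ck_id]. Qed.

Lemma smooth_sub V W (U U' : set V) (f : V -> W) :
  U' `<=` U -> smooth_on U f -> smooth_on U' f.
Proof. by move=> UU' sf k; exact: Ck_sub (sf k). Qed.

Lemma smooth_linear V W (U : set V) (f : {linear V -> W}) :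
  open U -> continuous f -> smooth_on U f.
Proof.
move=> oU cf [|k] /=; first by move=> x _; exact: cf.
split=> [x _|v]; first exact: linear_differentiable.
by apply: Ck_eq (Ck_cst k (f v) oU) => // x _; rewrite diff_lin.
Qed.

Lemma smooth_lsubmx m n (U : set 'rV[R]_(m + n)) :
  open U -> smooth_on U (@lsubmx R 1 m n).
Proof.
move=> oU; apply: smooth_linear => // x.
exact/differentiable_continuous/differentiable_lsubmx.
Qed.

End Smooth.

Section Diffeology.
Context {R : realType}.

(* A function from an open subset U of R^n to X is represented by a total     *)
(* function restricted to U: the values off U are irrelevant (plot_ext).      *)
Record diffeology (X : Type) := Diffeology {
  plot : forall n, set 'rV[R]_n -> ('rV[R]_n -> X) -> Prop;
  plot_open : forall n (U : set 'rV[R]_n) p, plot U p -> open U;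
  plot_ext : forall n (U : set 'rV[R]_n) p q,
    (forall u, U u -> p u = q u) -> plot U p -> plot U q;
  plot_cst : forall n (U : set 'rV[R]_n) (x : X), open U -> plot U (fun=> x);
  plot_comp : forall m n (U : set 'rV[R]_n) (V : set 'rV[R]_m) p f,
    plot U p -> open V -> smooth_on V f -> (forall v, V v -> U (f v)) ->
    plot V (p \o f);
  plot_cover : forall n (C : set (set 'rV[R]_n)) p,
    (forall U, C U -> plot U p) -> plot (\bigcup_(U in C) U) p }.

Definition smooth X Y (D : diffeology X) (E : diffeology Y) (f : X -> Y) :=
  forall n (U : set 'rV[R]_n) p, plot D U p -> plot E U (f \o p).

Definition finer X (D E : diffeology X) :=
  forall n (U : set 'rV[R]_n) p, plot D U p -> plot E U p.

(* The sub-diffeology, for a subset given as an injection i : A -> X. *)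
Definition sub_diffeology A X (i : A -> X) (D : diffeology X) : diffeology A.
Proof.
apply: (@Diffeology A (fun n U p => plot D U (i \o p))).
- by move=> n U p; exact: plot_open.
- by move=> n U p q pq; apply: plot_ext => u Uu; rewrite /= pq.
- by move=> n U a; exact: (plot_cst D (i a)).
- by move=> m n U V p f; exact: plot_comp.
- by move=> n C p; exact: plot_cover.
Defined.

Definition prod_diffeology X Y (D : diffeology X) (E : diffeology Y) :
  diffeology (X * Y).
Proof.
apply: (@Diffeology (X * Y)
  (fun n U p => plot D U (fst \o p) /\ plot E U (snd \o p))).
- by move=> n U p [+ _]; exact: plot_open.
- by move=> n U p q pq [Dp Ep]; split; [move: Dp|move: Ep];
    apply: plot_ext => u Uu; rewrite /= pq.
- by move=> n U [x y] oU; split; [exact: (plot_cst D x)|exact: (plot_cst E y)].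
- move=> m n U V p f [Dp Ep] oV sf fU.
  by split; [exact: plot_comp Dp _ _ _|exact: plot_comp Ep _ _ _].
- by move=> n C p H; split; apply: plot_cover => U /H [].
Defined.

Definition real_diffeology : diffeology R^o.
Proof.
apply: (@Diffeology R^o (fun n U p => open U /\ smooth_on U p)).
- by move=> n U p [].
- by move=> n U p q pq [oU sp]; split=> // k; exact: Ck_eq (sp k).
- by move=> n U a oU; split=> // k; exact: Ck_cst.
- by move=> m n U V p f [oU sp] oV sf fU; split=> //; exact: smooth_comp sp.
- move=> n C p H; split; first by apply: bigcup_open => U /H [].
  by move=> k; apply: Ck_bigcup => U /H [_]; exact.
Defined.

Definition inf_diffeology X (P : diffeology X -> Prop) : diffeology X.
Proof.
apply: (@Diffeology X
  (fun n U p => open U /\ forall D, P D -> plot D U p)).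
- by move=> n U p [].
- by move=> n U p q pq [oU H]; split=> // D /H; exact: plot_ext.
- by move=> n U x oU; split=> // D _; exact: plot_cst.
- move=> m n U V p f [oU H] oV sf fU; split=> // D /H Dp.
  exact: plot_comp Dp _ _ _.
- move=> n C p H; split; first by apply: bigcup_open => U /H [].
  by move=> D PD; apply: plot_cover => U /H [_]; exact.
Defined.

Definition is_dvs (V : lmodType R) (D : diffeology V) :=
  smooth (prod_diffeology D D) D (fun uv => uv.1 + uv.2) /\
  smooth (prod_diffeology D real_diffeology) D
    (fun vr => (vr.2 : R) *: vr.1).

Definition fine_diffeology (V : lmodType R) : diffeology V :=
  inf_diffeology (@is_dvs V).

Lemma fine_is_dvs (V : lmodType R) : is_dvs (@fine_diffeology V).
Proof.
split=> n U p [[oU Hp] [_ Hq]]; split=> // D dvsD; have [DD DR] := dvsD.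
  by apply: DD; split; [exact: Hp|exact: Hq].
by apply: DR; split; [exact: Hp|split].
Qed.

Definition is_fine_dvs (V : lmodType R) (D : diffeology V) :=
  is_dvs D /\
  forall n (U : set 'rV[R]_n) p, plot D U p <-> plot (fine_diffeology V) U p.

(* The fibre product of the total space with itself over X is represented by  *)
(* the triples (x, u, v) with u, v in the fibre T x.                          *)
Definition fibre_pair X (T : X -> lmodType R) (z : {x : X & (T x * T x)%type}) :
    {x : X & T x} * {x : X & T x} :=
  (existT _ (projT1 z) (projT2 z).1, existT _ (projT1 z) (projT2 z).2).

Definition fibre_add X (T : X -> lmodType R) (z : {x : X & (T x * T x)%type}) :
    {x : X & T x} :=
  existT _ (projT1 z) ((projT2 z).1 + (projT2 z).2).

Definition fibre_scale X (T : X -> lmodType R) (z : {x : X & T x} * R^o) :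
    {x : X & T x} :=
  existT _ (projT1 z.1) ((z.2 : R) *: projT2 z.1).

Definition is_dvs_over X (D : diffeology X) (T : X -> lmodType R)
    (E : diffeology {x : X & T x}) :=
  [/\ smooth E D (@projT1 X (fun x => T x)),
      smooth (sub_diffeology (@fibre_pair X T) (prod_diffeology E E)) E
        (@fibre_add X T)
    & smooth (prod_diffeology E real_diffeology) E (@fibre_scale X T)].

End Diffeology.
Arguments diffeology : clear implicits.

Record category := Category {
  obj :> Type;
  hom : obj -> obj -> Type;
  idm : forall a, hom a a;
  compm : forall a b c, hom b c -> hom a b -> hom a c;
  compm1 : forall a b (f : hom a b), compm f (idm a) = f;
  comp1m : forall a b (f : hom a b), compm (idm b) f = f;
  compmA : forall a b c d (h : hom c d) (g : hom b c) (f : hom a b),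
    compm h (compm g f) = compm (compm h g) f }.

Definition filtered (C : category) : Prop :=
  [/\ inhabited C,
      forall c d : C, exists e, inhabited (hom c e) /\ inhabited (hom d e)
    & forall (c d : C) (f g : hom c d), exists e (h : hom d e),
        compm h f = compm h g].

Record vect_functor (R : pzRingType) (C : category) := VectFunctor {
  fobj :> C -> lmodType R;
  fmap : forall a b : C, hom a b -> {linear fobj a -> fobj b};
  fmap1 : forall (a : C) v, fmap (idm a) v = v;
  fmapM : forall (a b c : C) (g : hom b c) (f : hom a b) v,
    fmap (compm g f) v = fmap g (fmap f v) }.

(* The colimit of F is presented by generators and relations: formal linear   *)
(* combinations of elements of the F c, modulo the vector space axioms, the   *)
(* linearity of F c -> colim F, and the identification of v with F f v.       *)
(* Its universal property is colim_univ below.                                *)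
Section Colimit.
Context {R : pzRingType} {C : category} (F : vect_functor R C).

Inductive cterm : Type :=
| CIn (c : C) (v : F c)
| CZero
| CAdd (s t : cterm)
| CScale (a : R) (t : cterm).

Inductive crel : cterm -> cterm -> Prop :=
| crel_refl s : crel s s
| crel_sym s t : crel s t -> crel t s
| crel_trans s t u : crel s t -> crel t u -> crel s u
| crel_add s s' t t' : crel s s' -> crel t t' -> crel (CAdd s t) (CAdd s' t')
| crel_scale a s s' : crel s s' -> crel (CScale a s) (CScale a s')
| crel_addA s t u : crel (CAdd s (CAdd t u)) (CAdd (CAdd s t) u)
| crel_addC s t : crel (CAdd s t) (CAdd t s)
| crel_add0 s : crel (CAdd CZero s) s
| crel_addN s : crel (CAdd (CScale (-1) s) s) CZero
| crel_scaleA a b s : crel (CScale a (CScale b s)) (CScale (a * b) s)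
| crel_scale1 s : crel (CScale 1 s) s
| crel_scaleDr a s t :
    crel (CScale a (CAdd s t)) (CAdd (CScale a s) (CScale a t))
| crel_scaleDl s a b :
    crel (CScale (a + b) s) (CAdd (CScale a s) (CScale b s))
| crel_linear c a (u v : F c) :
    crel (CIn (a *: u + v)) (CAdd (CScale a (CIn u)) (CIn v))
| crel_map c d (f : hom c d) (v : F c) : crel (CIn (fmap F f v)) (CIn v).

Definition crelb : rel {classic cterm} := fun s t => `[< crel s t >].

Lemma crelb_refl : reflexive crelb.
Proof. by move=> s; apply/asboolP; exact: crel_refl. Qed.

Lemma crelb_sym : symmetric crelb.
Proof.
by move=> s t; apply/asboolP/asboolP; exact: crel_sym.
Qed.

Lemma crelb_trans : transitive crelb.
Proof.
by move=> t s u /asboolP st /asboolP tu; apply/asboolP; exact: crel_trans tu.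
Qed.

Canonical crel_equiv := EquivRel crelb crelb_refl crelb_sym crelb_trans.

Definition colim := {eq_quot crel_equiv}.
HB.instance Definition _ := Choice.on colim.

Definition cclass (t : cterm) : colim := \pi_colim (t : {classic cterm}).

Lemma cclass_eq s t : crel s t -> cclass s = cclass t.
Proof. by move=> st; apply/eqmodP/asboolP. Qed.

Lemma cclassP s t : cclass s = cclass t -> crel s t.
Proof. by move=> /eqmodP/asboolP. Qed.

Lemma crepr_class t : crel (repr (cclass t)) t.
Proof. by apply: cclassP; exact: reprK. Qed.

Lemma cclass_repr (x : colim) : cclass (repr x) = x.
Proof. exact: reprK. Qed.

Definition colim_zero : colim := cclass CZero.
Definition colim_add (x y : colim) : colim := cclass (CAdd (repr x) (repr y)).
Definition colim_scale (a : R) (x : colim) : colim := cclass (CScale a (repr x)).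
Definition colim_opp (x : colim) : colim := colim_scale (-1) x.

Lemma cclassD s t : colim_add (cclass s) (cclass t) = cclass (CAdd s t).
Proof. by apply/cclass_eq/crel_add; exact: crepr_class. Qed.

Lemma cclassZ a s : colim_scale a (cclass s) = cclass (CScale a s).
Proof. by apply/cclass_eq/crel_scale; exact: crepr_class. Qed.

Lemma colim_ind (P : colim -> Prop) : (forall t, P (cclass t)) -> forall x, P x.
Proof. by move=> H x; rewrite -(cclass_repr x). Qed.

Lemma colim_addA : associative colim_add.
Proof.
elim/colim_ind=> s; elim/colim_ind=> t; elim/colim_ind=> u.
by rewrite !cclassD; exact/cclass_eq/crel_addA.
Qed.

Lemma colim_addC : commutative colim_add.
Proof.
elim/colim_ind=> s; elim/colim_ind=> t.
by rewrite !cclassD; exact/cclass_eq/crel_addC.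
Qed.

Lemma colim_add0 : left_id colim_zero colim_add.
Proof. by elim/colim_ind=> s; rewrite cclassD; exact/cclass_eq/crel_add0. Qed.

Lemma colim_addN : left_inverse colim_zero colim_opp colim_add.
Proof.
by elim/colim_ind=> s; rewrite /colim_opp cclassZ cclassD;
  exact/cclass_eq/crel_addN.
Qed.

HB.instance Definition _ := GRing.isZmodule.Build colim
  colim_addA colim_addC colim_add0 colim_addN.

Lemma colim_scaleA a b x :
  colim_scale a (colim_scale b x) = colim_scale (a * b) x.
Proof.
by elim/colim_ind: x => s; rewrite !cclassZ; exact/cclass_eq/crel_scaleA.
Qed.

Lemma colim_scale1 : left_id 1 colim_scale.
Proof. by elim/colim_ind=> s; rewrite cclassZ; exact/cclass_eq/crel_scale1. Qed.

Lemma colim_scaleDr : right_distributive colim_scale +%R.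
Proof.
move=> a; elim/colim_ind=> s; elim/colim_ind=> t.
rewrite /GRing.add /= cclassD !cclassZ cclassD.
exact/cclass_eq/crel_scaleDr.
Qed.

Lemma colim_scaleDl x : {morph colim_scale^~ x : a b / a + b}.
Proof.
elim/colim_ind: x => s a b; rewrite /= !cclassZ.
by rewrite [RHS]cclassD; exact/cclass_eq/crel_scaleDl.
Qed.

HB.instance Definition _ := GRing.Zmodule_isLmodule.Build R colim
  colim_scaleA colim_scale1 colim_scaleDr colim_scaleDl.

Definition colim_in (c : C) (v : F c) : colim := cclass (CIn v).

Lemma colim_in_is_linear c : linear (@colim_in c).
Proof.
move=> a u v; rewrite /GRing.scale /GRing.add /= /colim_in cclassZ cclassD.
exact/cclass_eq/crel_linear.
Qed.

HB.instance Definition _ c :=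
  GRing.isLinear.Build R (F c) colim *:%R (@colim_in c) (@colim_in_is_linear c).

Lemma colim_in_map c d (f : hom c d) v : colim_in (fmap F f v) = colim_in v.
Proof. exact/cclass_eq/crel_map. Qed.

Lemma colim_univ (W : lmodType R) (g : forall c : C, {linear F c -> W}) :
  (forall c d (f : hom c d) v, g d (fmap F f v) = g c v) ->
  exists h : {linear colim -> W},
    (forall c (v : F c), h (colim_in v) = g c v) /\
    forall h' : {linear colim -> W},
      (forall c (v : F c), h' (colim_in v) = g c v) -> h' =1 h.
Proof.
move=> gf.
pose fix ev (t : cterm) : W := match t with
  | CIn c v => g c v | CZero => 0 | CAdd s t => ev s + ev t
  | CScale a t => a *: ev t end.
have evE s t : crel s t -> ev s = ev t.
  elim=> //=.
  - by move=> ? ? ? _ -> _ ->.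
  - by move=> ? ? ? ? _ -> _ ->.
  - by move=> ? ? ? _ ->.
  - by move=> *; rewrite addrA.
  - by move=> *; rewrite addrC.
  - by move=> *; rewrite add0r.
  - by move=> *; rewrite scaleN1r addNr.
  - by move=> *; rewrite scalerA.
  - by move=> *; rewrite scale1r.
  - by move=> *; rewrite scalerDr.
  - by move=> *; rewrite scalerDl.
  - by move=> *; rewrite linearP.
pose h (x : colim) := ev (repr x).
have hE t : h (cclass t) = ev t by apply: evE; exact: crepr_class.
have lh : linear h.
  move=> a; elim/colim_ind=> s; elim/colim_ind=> t.
  by rewrite /GRing.scale /GRing.add /= cclassZ cclassD !hE.
pose hM := GRing.isLinear.Build _ _ _ _ _ lh.
pose hL : {linear colim -> W} := HB.pack h hM.
exists hL; split=> [c v|h' h'E]; first exact: hE.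
elim/colim_ind=> t; rewrite [RHS]hE; elim: t => /=.
- exact: h'E.
- exact: (linear0 h').
- by move=> s <- t <-; rewrite -linearD; congr (h' _); rewrite -cclassD.
- by move=> a t <-; rewrite -linearZ; congr (h' _); rewrite -cclassZ.
Qed.

End Colimit.

Section GermCategory.
Context {R : realType} {X : Type} (D : diffeology R X) (x : X).

Record pointed_plot := PointedPlot {
  pp_dim : nat;
  pp_dom : set 'rV[R]_pp_dim;
  pp_map : 'rV[R]_pp_dim -> X;
  pp_plot : plot D pp_dom pp_map;
  pp_connected : connected pp_dom;
  pp_dom0 : pp_dom 0;
  pp_map0 : pp_map 0 = x }.
Arguments pp_map : clear implicits.
Arguments pp_dom : clear implicits.

Record germ_rep (p q : pointed_plot) := GermRep {
  germ_fun :> 'rV[R]_(pp_dim p) -> 'rV[R]_(pp_dim q);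
  germ_funP : exists W : set 'rV[R]_(pp_dim p),
    [/\ open W, W 0 & W `<=` pp_dom p] /\
    [/\ smooth_on W germ_fun, germ_fun 0 = 0,
        forall w, W w -> pp_dom q (germ_fun w)
      & forall w, W w -> pp_map p w = pp_map q (germ_fun w)] }.

Definition germ_eq p q : rel {classic germ_rep p q} :=
  fun f g => `[< \forall w \near (0 : 'rV[R]_(pp_dim p)), germ_fun f w = germ_fun g w >].

Lemma germ_eq_refl p q : reflexive (@germ_eq p q).
Proof. by move=> f; apply/asboolP; near=> w. Unshelve. all: end_near. Qed.

Lemma germ_eq_sym p q : symmetric (@germ_eq p q).
Proof.
by move=> f g; apply/asboolP/asboolP; apply: filterS => w.
Qed.

Lemma germ_eq_trans p q : transitive (@germ_eq p q).
Proof.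
move=> g f h /asboolP fg /asboolP gh; apply/asboolP.
by apply: filterS2 fg gh => w ->.
Qed.

Canonical germ_equiv p q :=
  EquivRel (@germ_eq p q) (@germ_eq_refl p q) (@germ_eq_sym p q)
    (@germ_eq_trans p q).

Definition germ p q := {eq_quot germ_equiv p q}.

Definition germ_of p q (f : germ_rep p q) : germ p q :=
  \pi_(germ p q) (f : {classic germ_rep p q}).

Lemma germ_ofP p q (f g : germ_rep p q) :
  germ_of f = germ_of g <-> \forall w \near (0 : 'rV[R]_(pp_dim p)), f w = g w.
Proof.
split; first by move=> /eqmodP/asboolP.
by move=> fg; apply/eqmodP/asboolP.
Qed.

Definition germ_repr p q (f : germ p q) : germ_rep p q := repr f.

Lemma germ_reprK p q (f : germ p q) : germ_of (germ_repr f) = f.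
Proof. exact: reprK. Qed.

Lemma germ_repr_of p q (f : germ_rep p q) :
  \forall w \near (0 : 'rV[R]_(pp_dim p)), germ_repr (germ_of f) w = f w.
Proof. by apply/germ_ofP; exact: germ_reprK. Qed.

Lemma germ_ind p q (P : germ p q -> Prop) :
  (forall f, P (germ_of f)) -> forall f, P f.
Proof. by move=> H f; rewrite -(germ_reprK f). Qed.

Lemma germ_rep0 p q (f : germ_rep p q) : f 0 = 0.
Proof. by have [W [_ []]] := germ_funP f. Qed.

Lemma germ_rep_diff p q (f : germ_rep p q) : differentiable f 0.
Proof.
by have [W [[_ W0 _] [/(_ 1%N)[df _] _ _ _]]] := germ_funP f; exact: df.
Qed.

Lemma germ_rep_cvg p q (f : germ_rep p q) :
  f w @[w --> (0 : 'rV[R]_(pp_dim p))] --> (0 : 'rV[R]_(pp_dim q)).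
Proof.
rewrite -[X in _ --> X](germ_rep0 f).
exact/differentiable_continuous/germ_rep_diff.
Qed.

Lemma germ_rep_idP p : exists W : set 'rV[R]_(pp_dim p),
  [/\ open W, W 0 & W `<=` pp_dom p] /\
  [/\ smooth_on W (@idfun 'rV[R]_(pp_dim p)), @idfun 'rV[R]_(pp_dim p) 0 = 0,
      forall w, W w -> pp_dom p (idfun w)
    & forall w, W w -> pp_map p w = pp_map p (idfun w)].
Proof.
exists (pp_dom p); have oU := plot_open (pp_plot p).
split; split=> //; first exact: pp_dom0.
exact: smooth_id.
Qed.

Definition germ_rep_id p : germ_rep p p := GermRep (germ_rep_idP p).

Lemma germ_rep_compP p q r (g : germ_rep q r) (f : germ_rep p q) :
  exists W : set 'rV[R]_(pp_dim p),
  [/\ open W, W 0 & W `<=` pp_dom p] /\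
  [/\ smooth_on W (g \o f), (g \o f) 0 = 0,
      forall w, W w -> pp_dom r ((g \o f) w)
    & forall w, W w -> pp_map p w = pp_map r ((g \o f) w)].
Proof.
have [V [[oV V0 Vq] [sg g0 gV gE]]] := germ_funP g.
have [W [[oW W0 Wp] [sf f0 fW fE]]] := germ_funP f.
have oWV : open (W `&` f @^-1` V).
  rewrite openE => w [Ww Vfw]; apply: filterI.
    by move: oW; rewrite openE; exact.
  have cf : {for w, continuous f} := sf 0%N w Ww.
  by apply: cf; move: oV; rewrite openE; exact.
exists (W `&` f @^-1` V); split; split=> //.
- by split=> //=; rewrite f0.
- by move=> w [/Wp].
- apply: (smooth_comp oWV _ _ sg); first by move=> w [].
  by apply: smooth_sub sf => w [].
- by rewrite /= f0 g0.
- by move=> w [Ww Vfw]; exact: gV.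
- by move=> w [Ww Vfw]; rewrite fE// gE.
Qed.

Definition germ_rep_comp p q r (g : germ_rep q r) (f : germ_rep p q) :
  germ_rep p r := GermRep (germ_rep_compP g f).

Definition germ_id p : germ p p := germ_of (germ_rep_id p).

Definition germ_comp p q r (g : germ q r) (f : germ p q) : germ p r :=
  germ_of (germ_rep_comp (germ_repr g) (germ_repr f)).

Lemma germ_compE p q r (g : germ_rep q r) (f : germ_rep p q) :
  germ_comp (germ_of g) (germ_of f) = germ_of (germ_rep_comp g f).
Proof.
apply/germ_ofP => /=.
have gE : \forall w \near (0 : 'rV[R]_(pp_dim p)),
    germ_repr (germ_of g) (f w) = g (f w).
  have h := germ_rep_cvg f (germ_repr_of g).
  exact: h.
have fE := germ_repr_of f.
near=> w; have -> : germ_repr (germ_of f) w = f w by near: w.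
by near: w.
Unshelve. all: end_near. Qed.

Lemma germ_comp1 p q (f : germ p q) : germ_comp f (germ_id p) = f.
Proof.
elim/germ_ind: f => f; rewrite germ_compE.
by apply/germ_ofP; near=> w.
Unshelve. all: end_near. Qed.

Lemma germ_1comp p q (f : germ p q) : germ_comp (germ_id q) f = f.
Proof.
elim/germ_ind: f => f; rewrite germ_compE.
by apply/germ_ofP; near=> w.
Unshelve. all: end_near. Qed.

Lemma germ_compA p q r s (h : germ r s) (g : germ q r) (f : germ p q) :
  germ_comp h (germ_comp g f) = germ_comp (germ_comp h g) f.
Proof.
elim/germ_ind: h => h; elim/germ_ind: g => g; elim/germ_ind: f => f.
by rewrite !germ_compE; apply/germ_ofP; near=> w.
Unshelve. all: end_near. Qed.

Definition germ_category : category :=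
  Category germ_comp1 germ_1comp germ_compA.

Definition germ_diff (p q : germ_category) (f : hom p q) :
  {linear 'rV[R]_(pp_dim p) -> 'rV[R]_(pp_dim q)} := 'd (germ_repr f) 0.

Lemma germ_diffE p q (f : germ_rep p q) :
  germ_diff (germ_of f) = 'd f 0 :> ('rV[R]_(pp_dim p) -> 'rV[R]_(pp_dim q)).
Proof.
have ff : \forall w \near (0 : 'rV[R]_(pp_dim p)), f w = germ_repr (germ_of f) w.
  by apply: filterS (germ_repr_of f) => w.
have [_ E] := near_eq_diff ff (germ_rep_diff f).
rewrite /germ_diff; exact: E.
Qed.

Lemma germ_diff1 (p : germ_category) v : germ_diff (idm p) v = v.
Proof. by rewrite germ_diffE diff_val. Qed.

Lemma germ_diffM (p q r : germ_category) (g : hom q r) (f : hom p q) v :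
  germ_diff (compm g f) v = germ_diff g (germ_diff f v).
Proof.
rewrite [compm _ _]/(germ_comp g f) /germ_comp germ_diffE /=.
have f0 := germ_rep0 (germ_repr f).
rewrite (@diff_comp _ _ _ _ (germ_repr f) (germ_repr g) 0) /germ_diff ?f0//.
- exact: germ_rep_diff.
- exact: germ_rep_diff.
Qed.

Definition tangent_functor : vect_functor R germ_category :=
  @VectFunctor R germ_category (fun p => 'rV[R]_(pp_dim p))
    germ_diff germ_diff1 germ_diffM.

Definition internal_tangent : lmodType R := colim tangent_functor.

End GermCategory.

Section TangentBundle.
Context {R : realType} {X : Type} (D : diffeology R X).

Definition tangent_bundle := {y : X & internal_tangent D y}.

Lemma rV_ball_connected n (u : 'rV[R]_n) e : 0 < e -> connected (ball u e).
Proof.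
move=> e0.
have -> : ball u e = \bigcup_(y in ball u e)
    ((fun t : R => u + t *: (y - u)) @` `[0, 1]).
  apply/seteqP; split=> [y uy|z [y uy [t /=]]].
    exists y => //; exists 1; first by rewrite /= in_itv /= ler01 lexx.
    by rewrite scale1r addrC subrK.
  rewrite in_itv /= => /andP[t0 t1] <-; move: uy.
  rewrite -!ball_normE /= opprD addrA subrr add0r normrN normrZ ger0_norm//.
  by rewrite distrC; apply: le_lt_trans; rewrite ler_piMl.
apply: bigcup_connected.
  exists u => y _; exists 0; first by rewrite /= in_itv /= ler01 lexx.
  by rewrite scale0r addr0.
move=> y _; apply: connected_continuous_connected.
  exact: segment_connected.
apply: continuous_subspaceT => t.
by apply: cvgD; [exact: cvg_cst|apply: cvgZr_tmp; exact: cvg_id].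
Qed.

Lemma rV_component_open n (A : set 'rV[R]_n) u :
  open A -> open (connected_component A u).
Proof.
move=> oA; rewrite openE => w Cw.
have Aw : A w := connected_component_sub Cw.
have /nbhs_ballP[e /= e0 eA] := open_nbhs_nbhs (conj oA Aw).
apply/nbhs_ballP; exists e => //= z wz.
rewrite (same_connected_component Cw).
apply: (connected_component_max (ballxx w e0) eA) wz.
exact: rV_ball_connected.
Qed.

Section Translate.
Context {n : nat} {U : set 'rV[R]_n} {p : 'rV[R]_n -> X} (pl : plot D U p).

(* The set of w with u + w in U need not be connected, so we restrict to the  *)
(* component of 0.                                                            *)
Definition translate_dom (u : 'rV[R]_n) : set 'rV[R]_n :=
  connected_component [set w | U (u + w)] 0.

Lemma translate_open u : open [set w | U (u + w)].
Proof.
have oU := plot_open pl.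
apply: (open_comp (f := fun w => u + w)) => // w _.
exact: (@smooth_shift _ _ setT u openT 0%N w).
Qed.

Lemma translate_plot u : plot D (translate_dom u) (p \o (fun w => u + w)).
Proof.
have oC : open (translate_dom u).
  exact: (@rV_component_open _ _ 0 (@translate_open u)).
have sf : smooth_on (translate_dom u) (fun w => u + w) := smooth_shift u oC.
have fU w : translate_dom u w -> U (u + w) := @connected_component_sub _ _ _ w.
exact: (plot_comp pl oC sf fU).
Qed.

Lemma translate_dom0 u : U u -> translate_dom u 0.
Proof. by move=> Uu; apply: connected_component_refl; rewrite /= addr0. Qed.

Definition translate u (Uu : U u) : pointed_plot D (p u) :=
  PointedPlot (translate_plot u) (@component_connected _ _ _)
    (translate_dom0 Uu) (congr1 p (addr0 u)).

(* The element of T_{p u}(X) represented by v, for u in U. *)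
Definition tangent_class u (Uu : U u) (v : 'rV[R]_n) :
    internal_tangent D (p u) :=
  @colim_in _ _ (tangent_functor D (p u)) (translate Uu) v.

(* TU is the open subset U x R^n of R^(n + n); off it the value is junk. *)
Definition tangent_dom : set 'rV[R]_(n + n) := [set w | U (lsubmx w)].

Definition tangent_map (w : 'rV[R]_(n + n)) : tangent_bundle :=
  existT (fun y => internal_tangent D y) (p (lsubmx w))
    (if pselect (U (lsubmx w)) is left Uu then tangent_class Uu (rsubmx w)
     else (0 : internal_tangent D (p (lsubmx w)))).

End Translate.

(* The clause on E says that every tangent_map pl, defined on TU with its     *)
(* standard diffeology, is smooth into E.                                     *)
Definition hector_diffeology : diffeology R tangent_bundle :=
  inf_diffeology (fun E =>
    forall n (U : set 'rV[R]_n) p (pl : plot D U p),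
    forall m (W : set 'rV[R]_m) (f : 'rV[R]_m -> 'rV[R]_(n + n)),
      open W -> smooth_on W f -> (forall w, W w -> @tangent_dom n U (f w)) ->
      plot E W (tangent_map pl \o f)).

Definition dvs_diffeology : diffeology R tangent_bundle :=
  inf_diffeology (fun E =>
    finer hector_diffeology E /\ is_dvs_over D E).

Lemma hector_tangent_map n (U : set 'rV[R]_n) p (pl : plot D U p)
    m (W : set 'rV[R]_m) (f : 'rV[R]_m -> 'rV[R]_(n + n)) :
  open W -> smooth_on W f -> (forall w, W w -> @tangent_dom n U (f w)) ->
  plot hector_diffeology W (tangent_map pl \o f).
Proof. by move=> oW sf fW; split=> // E; exact. Qed.

Let projX : tangent_bundle -> X := @projT1 X (fun y => internal_tangent D y).

Lemma hector_proj : finer hector_diffeology (sub_diffeology projX D).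
Proof.
move=> k W' q [_]; apply=> n U p pl m W f oW sf fW.
apply: (@plot_comp _ _ D m n U W p (lsubmx \o f) pl oW) fW.
exact: (@smooth_comp _ _ _ _ _ setT _ _ oW _ sf (smooth_lsubmx openT)).
Qed.

Lemma sub_proj_dvs_over :
  is_dvs_over (T := internal_tangent D) D (sub_diffeology projX D).
Proof.
split; first by [].
- by move=> n U p [].
- by move=> n U p [].
Qed.

Lemma dvs_diffeologyP :
  finer hector_diffeology dvs_diffeology /\
  is_dvs_over (T := internal_tangent D) D dvs_diffeology.
Proof.
split; first by move=> n U p hp; split;
  [exact: plot_open hp|move=> E [+ _]; exact].
split.
- by move=> n U p [_ /(_ _ (conj hector_proj sub_proj_dvs_over))].
- move=> n U p [[oU Hp] [_ Hq]]; split=> // E HE; have [_ [_ EE _]] := HE.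
  by apply: EE; split; [exact: Hp|exact: Hq].
- move=> n U p [[oU Hp] Hr]; split=> // E HE; have [_ [_ _ ER]] := HE.
  by apply: ER; split; [exact: Hp|exact: Hr].
Qed.

Definition fibre_diffeology (x : X) (E : diffeology R tangent_bundle) :
    diffeology R (internal_tangent D x) :=
  sub_diffeology (fun v => existT (fun y => internal_tangent D y) x v) E.

End TangentBundle.

(* Main.v *)
Require Import Defs.
From mathcomp Require Import all_boot all_order all_algebra.
From mathcomp Require Import all_classical all_reals all_analysis.

Set Implicit Arguments.
Unset Strict Implicit.
Unset Printing Implicit Defensive.
Import Order.TTheory GRing.Theory Num.Theory.
Import numFieldNormedType.Exports.

Local Open Scope classical_set_scope.
Local Open Scope ring_scope.

(** Let L ([lift_diffeology]) be the diffeology on T_x(X) whose plots locally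
    factor as a smooth map into the tangent space R^n of a single pointed plot,
    followed by the canonical map R^n -> T_x(X).  The theorem holds because L is
    the fine diffeology and both fibre diffeologies coincide with L.

    Filteredness first says that finitely many elements of the colimit come
    from one pointed plot.  Hence constants are plots of L, and sums of plots
    of L are plots of L, because two local factorisations can be moved to a
    common target ([lift_is_dvs]).  Conversely a smooth family in R^n is a
    combination of n constant vectors with smooth coefficients, so every vector
    space diffeology contains L ([lift_finer]).  So L is fine.

    A plot r of R^n gives the smooth map (0, r) into the tangent bundle of a
    pointed plot p, so L is contained in the fibre of Hector's diffeology
    ([lift_finer_hector]), which is contained in the fibre of the dvs diffeology.

    What remains is that the fibre of the dvs diffeology is contained in L.
    Its crux is [tangent_map_lift], which treats Tp o (u, v) when p o u is
    constantly x.  The family of translates of p by u(w) seems to involve a new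
    pointed plot for each w.  But all these translates are restrictions of one
    plot Q(a, b) = p(u(w0 + a) + b), and a |-> (a, 0) and a |-> 0 are two germs
    from the constant plot at x to Q.  A germ h coequalising them satisfies
    h(a, 0) = 0 for all small a, so b |-> h(a, b) is, for each such a, a germ at
    0 from the translate by u(w0 + a) to the target of h.  Thus the class of
    v(w) is represented at that one target by the derivative of h at (w - w0, 0)
    in the direction (0, v(w)), which is smooth in w.

    To pass from generators to all plots of the dvs diffeology,
    [fibre_test_diffeology] is the largest diffeology over X whose plots, once
    pulled back into the fibre over x, are plots of L.  It is a diffeological
    vector space over X because L is a diffeological vector space, and it
    contains the generators by [tangent_map_lift]; by minimality it contains the
    dvs diffeology. *)

(** * Smooth maps between Euclidean spaces *)

Section SmoothMaps.
Context {R : realType}.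
Implicit Types V W : normedModType R.

Lemma smooth_add V W (U : set V) (f g : V -> W) : open U ->
  smooth_on U f -> smooth_on U g -> smooth_on U (fun x => f x + g x).
Proof. by move=> oU sf sg k; exact: CkD. Qed.

Lemma smooth_eq V W (U : set V) (f g : V -> W) : open U ->
  (forall x, U x -> f x = g x) -> smooth_on U f -> smooth_on U g.
Proof. by move=> oU fg sf k; exact: Ck_eq (sf k). Qed.

Lemma smooth_linear_rV n W (U : set 'rV[R]_n) (f : {linear 'rV[R]_n -> W}) :
  open U -> smooth_on U f.
Proof.
move=> oU k.
pose s (y : 'rV[R]_n) : W := \sum_(i < n) (y ord0 i : R) *: f (delta_mx ord0 i).
have fE y : f y = s y.
  rewrite /s [in LHS](row_sum_delta y) linear_sum.
  by apply: eq_bigr => i _; rewrite linearZ.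
apply: (@Ck_eq R _ W k U s) => //; apply: Ck_sum => // i.
apply: (@Ck_scale R _ W k U (fun y => y ord0 i : R^o)
  (fun=> f (delta_mx ord0 i))) => //; last exact: Ck_cst.
by apply: (@Ck_coord R _ _ k U idfun) => //; exact: Ck_id.
Qed.

Lemma smooth_row_mx V m n (U : set V) (f : V -> 'rV[R]_m) (g : V -> 'rV[R]_n) :
  open U -> smooth_on U f -> smooth_on U g ->
  smooth_on U (fun y => row_mx (f y) (g y)).
Proof.
move=> oU sf sg.
apply: (@smooth_eq _ _ _ (fun y => (mulmxr (row_mx 1%:M 0) \o f) y
    + (mulmxr (row_mx 0 1%:M) \o g) y)) => //.
  move=> y _; rewrite /= !mul_mx_row !mulmx1 !mulmx0 add_row_mx.
  by rewrite addr0 add0r.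
by apply: smooth_add => //; apply: (@smooth_comp _ _ _ _ _ setT) => //;
  exact: smooth_linear_rV openT.
Qed.

Lemma smooth_preimage_open V W (U : set V) (B : set W) (f : V -> W) :
  open U -> open B -> smooth_on U f -> open (U `&` f @^-1` B).
Proof.
move=> oU oB sf; rewrite openE => y [Uy By]; apply: filterI.
  exact: open_nbhs_nbhs.
by apply: (sf 0%N y Uy); exact: open_nbhs_nbhs.
Qed.

(** In coordinates the derivative in a moving direction is a combination of the
    partial derivatives, which are smooth, with smooth coefficients. *)
Lemma smooth_diff V m W (U : set V) (U' : set 'rV[R]_m)
    (f : 'rV[R]_m -> W) (g v : V -> 'rV[R]_m) :
  open U -> (forall y, U y -> U' (g y)) ->
  smooth_on U' f -> smooth_on U g -> smooth_on U v ->
  smooth_on U (fun y => 'd f (g y) (v y)).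
Proof.
move=> oU gU sf sg sv k.
pose e i : 'rV[R]_m := delta_mx ord0 i.
pose s y : W := \sum_(i < m)
  (v y ord0 i : R) *: ((fun z => 'd f z (e i)) \o g) y.
apply: (@Ck_eq R V W k U s) => //.
  move=> y Uy; rewrite /s /= [in RHS](row_sum_delta (v y)) linear_sum.
  by apply: eq_bigr => i _; rewrite linearZ.
apply: Ck_sum => // i.
apply: (@Ck_scale R V W k U (fun y => v y ord0 i : R^o)
  ((fun z => 'd f z (e i)) \o g)) => //.
  exact: (Ck_coord _ oU (sv k)).
by apply: (Ck_comp oU gU (sg k)); have [_] := sf k.+1; exact.
Qed.

Lemma diff_affine V W (f : V -> W) (l : {linear V -> W}) (c : W) (x v : V) :
  continuous l -> (forall y, f y = c + l y) -> 'd f x v = l v.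
Proof.
move=> cl fE.
have dl : differentiable l x by exact: linear_differentiable.
have -> : f = cst c + l by exact/funext.
rewrite diffD// diff_cst diff_lin//.
exact: add0r.
Qed.

Lemma diff_row_mx m n (a : 'rV[R]_m) (b v : 'rV[R]_n) :
  'd (fun c : 'rV[R]_n => row_mx a c) b v = row_mx 0 v.
Proof.
pose r : {linear 'rV[R]_n -> 'rV[R]_(m + n)} := mulmxr (row_mx 0 1%:M).
have rE c : r c = row_mx 0 c by rewrite /r /= mul_mx_row mulmx0 mulmx1.
have cr : continuous r by move=> c; exact: (smooth_linear_rV r openT 0%N).
rewrite -rE; apply: (@diff_affine _ _ _ r (row_mx a 0)) => // c.
by rewrite rE add_row_mx addr0 add0r.
Qed.

End SmoothMaps.

(** * Filtered colimits of vector spaces *)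

Section FilteredColimit.
Context {R : pzRingType} {C : category} (F : vect_functor R C).
Context (hC : filtered C).

Lemma filtered_common (c d : C) :
  exists (e : C) (f : Defs.hom c e) (g : Defs.hom d e), True.
Proof. by have [_ /(_ c d)[e [[f] [g]]] _] := hC; exists e, f, g. Qed.

(** The elements represented at a single object form a subspace, because two
    representatives can be moved to a common object before being added. *)
Lemma colim_in_surj (t : colim F) : exists c v, t = colim_in (c := c) v.
Proof.
move: t; apply: colim_ind.
elim=> [c v||s [c [v sE]] t [d [w tE]]|a s [c [v sE]]].
- by exists c, v.
- by have [[c] _ _] := hC; exists c, 0; rewrite linear0.
- have [e [f [g _]]] := filtered_common c d.
  exists e, (Defs.fmap F f v + Defs.fmap F g w).
  rewrite -cclassD sE tE -(colim_in_map f) -(colim_in_map g).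
  exact/esym/linearD.
- by exists c, (a *: v); rewrite -cclassZ sE; exact/esym/linearZ.
Qed.

End FilteredColimit.

(** * Diffeologies *)

Section Diffeologies.
Context {R : realType}.

Lemma plot_local X (D : diffeology R X) n (U : set 'rV[R]_n) p :
  (forall u, U u -> exists V, [/\ V u, V `<=` U & plot D V p]) -> plot D U p.
Proof.
move=> H.
have -> : U = \bigcup_(V in [set V | V `<=` U /\ plot D V p]) V.
  apply/seteqP; split=> [u /H[V [Vu VU pV]]|u [V [VU _] Vu]]; last exact: VU.
  by exists V.
by apply: plot_cover => V [].
Qed.

Lemma existT_inj X (T : X -> Type) x (a b : T x) :
  existT T x a = existT T x b -> a = b.
Proof.
move=> e; have := projT2_eq e.
by rewrite (Prop_irrelevance (projT1_eq e) erefl).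
Qed.

Lemma fibre_add_inv X (T : X -> lmodType R) z x (t : T x) :
  fibre_add z = existT (fun y => T y : Type) x t -> exists a b : T x,
    fibre_pair z = (existT _ x a, existT _ x b) /\ t = a + b.
Proof.
case: z => y [a b] e; have /= yx := projT1_eq e; subst y.
by exists a, b; split=> //; rewrite -(existT_inj e).
Qed.

Lemma fibre_scale_inv X (T : X -> lmodType R) z x (t : T x) :
  fibre_scale z = existT (fun y => T y : Type) x t -> exists a : T x,
    z.1 = existT _ x a /\ t = (z.2 : R) *: a.
Proof.
case: z => [[y a] c] e; have /= yx := projT1_eq e; subst y.
by exists a; split=> //; rewrite -(existT_inj e).
Qed.

(** The map l o r is the combination of the constant vectors l(e_i) with the
    smooth coordinates of r as coefficients. *)
Lemma dvs_plot_linear (V : lmodType R) (E : diffeology R V) m n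
    (U : set 'rV[R]_m) (l : {linear 'rV[R]_n -> V}) (r : 'rV[R]_m -> 'rV[R]_n) :
  is_dvs E -> open U -> smooth_on U r -> plot E U (l \o r).
Proof.
move=> [addE scaleE] oU sr.
have sumE k (g : 'I_k -> 'rV[R]_m -> V) : (forall i, plot E U (g i)) ->
    plot E U (fun y => \sum_(i < k) g i y).
  elim: k g => [|k IH] g gE.
    by apply: plot_ext (plot_cst E 0 oU) => u _; rewrite big_ord0.
  apply: (@plot_ext _ _ _ _ _
    (fun y => g ord0 y + \sum_(i < k) g (lift ord0 i) y)).
    by move=> y _; rewrite big_ord_recl.
  apply: (addE _ U (fun y => (g ord0 y, \sum_(i < k) g (lift ord0 i) y))).
  by split; [exact: gE|exact: IH].
apply: (@plot_ext _ _ _ _ _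
  (fun y => \sum_(i < n) (r y ord0 i : R) *: l (delta_mx ord0 i))).
  move=> y _; rewrite /= [in RHS](row_sum_delta (r y)) linear_sum.
  by apply: eq_bigr => i _; rewrite linearZ.
apply: sumE => i.
apply: (scaleE _ U (fun y => (l (delta_mx ord0 i), r y ord0 i : R^o))).
split; first exact: plot_cst.
by split=> // k; exact: Ck_coord.
Qed.

End Diffeologies.

(** * Germs and representatives of tangent vectors *)

Section Germs.
Context {R : realType} {X : Type} (D : diffeology R X) (x : X).

(** Continuity of f allows W to be shrunk so that f takes its values in the
    domain of q; the compatibility with p and q is therefore only asked where it
    makes sense. *)
Lemma germ_rep_near (p q : pointed_plot D x) (W : set 'rV[R]_(pp_dim p))
    (f : 'rV[R]_(pp_dim p) -> 'rV[R]_(pp_dim q)) :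
  open W -> W 0 -> smooth_on W f -> f 0 = 0 ->
  (forall w, W w -> pp_dom w -> pp_dom (f w) -> pp_map w = pp_map (f w)) ->
  exists g : germ_rep p q, germ_fun g = f.
Proof.
move=> oW W0 sf f0 pq.
have oU := plot_open (pp_plot p); have oV := plot_open (pp_plot q).
pose W' := (W `&` @pp_dom _ _ _ _ p) `&` f @^-1` (@pp_dom _ _ _ _ q).
have oW' : open W'.
  apply: smooth_preimage_open => //; first exact: openI.
  by apply: smooth_sub sf => w [].
have H : exists W : set 'rV[R]_(pp_dim p),
    [/\ open W, W 0 & W `<=` @pp_dom _ _ _ _ p] /\
    [/\ smooth_on W f, f 0 = 0, forall w, W w -> pp_dom (f w)
      & forall w, W w -> pp_map w = pp_map (f w)].
  exists W'; split; split=> //.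
  - by split; [split=> //; exact: pp_dom0|rewrite /= f0; exact: pp_dom0].
  - by move=> w [[]].
  - by apply: smooth_sub sf => w [[]].
  - by move=> w [].
  - by move=> w [[Ww pw] qw]; exact: pq.
by exists (GermRep H).
Qed.

(** The structure map of the colimit, with its domain displayed as a space of
    row vectors. *)
Definition tangent_in (p : pointed_plot D x) :
  {linear 'rV[R]_(pp_dim p) -> internal_tangent D x} :=
  GRing.Linear.clone R _ (internal_tangent D x) _
    (@colim_in _ _ (tangent_functor D x) p) _.

Lemma tangent_in_germ (p q : pointed_plot D x) (g : germ_rep p q) v :
  tangent_in q ('d g 0 v) = tangent_in p v.
Proof.
rewrite -germ_diffE; exact: (@colim_in_map _ _ (tangent_functor D x) p q).
Qed.

(** [translate] is pointed at p u; carrying a proof of p u = x here keeps all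
    pointed plots in the one germ category at x. *)
Definition translate_at n (U : set 'rV[R]_n) p (pl : plot D U p) u
    (Uu : U u) (px : p u = x) : pointed_plot D x :=
  PointedPlot (translate_plot pl u) (@component_connected _ _ _)
    (translate_dom0 Uu) (etrans (congr1 p (addr0 u)) px).

Lemma translate_at_sub n (U : set 'rV[R]_n) p (pl : plot D U p) u
    (Uu : U u) (px : p u = x) w :
  pp_dom (p := translate_at pl Uu px) w -> U (u + w).
Proof. exact: connected_component_sub. Qed.

End Germs.

Lemma tangent_mapE (R : realType) X (D : diffeology R X) x n (U : set 'rV[R]_n)
    p (pl : plot D U p) w (Uu : U (lsubmx w)) (px : p (lsubmx w) = x) :
  tangent_map pl w = existT (fun y => internal_tangent D y) x
    (tangent_in (translate_at pl Uu px) (rsubmx w)).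
Proof.
case: _ / px; rewrite /tangent_map; congr existT.
by case: pselect => // Uu'; rewrite (Prop_irrelevance Uu' Uu).
Qed.

(** * The fine diffeology on a filtered tangent space *)

Section FilteredFibre.
Context {R : realType} {X : Type} (D : diffeology R X) (x : X).
Context (hX : filtered (germ_category D x)).

Definition lifts_on n (V : set 'rV[R]_n)
    (q : 'rV[R]_n -> internal_tangent D x) : Prop :=
  open V /\ exists (p : pointed_plot D x) (r : 'rV[R]_n -> 'rV[R]_(pp_dim p)),
    smooth_on V r /\ forall w, V w -> q w = tangent_in p (r w).

Definition locally_lifts n (U : set 'rV[R]_n)
    (q : 'rV[R]_n -> internal_tangent D x) : Prop :=
  open U /\ forall u, U u -> exists V, [/\ V u, V `<=` U & lifts_on V q].

Lemma tangent_in_surj (t : internal_tangent D x) :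
  exists p v, t = tangent_in p v.
Proof.
by have [p [v ->]] := @colim_in_surj _ _ (tangent_functor D x) hX t; exists p, v.
Qed.

Definition lift_diffeology : diffeology R (internal_tangent D x).
Proof.
apply: (@Diffeology R _ locally_lifts).
- by move=> n U p [].
- move=> n U p q pq [oU H]; split=> // u /H[V [Vu VU [oV [c [r [sr rE]]]]]].
  exists V; split=> //; split=> //; exists c, r; split=> // w Vw.
  by rewrite -rE// pq//; exact: VU.
- move=> n U t oU; split=> // u Uu; exists U; split=> //; split=> //.
  have [p [v tE]] := tangent_in_surj t.
  exists p, (fun=> v); split=> [k|//]; exact: Ck_cst.
- move=> m n U V p f [oU H] oV sf fU; split=> // v Vv.
  have [W [Wf WU [oW [c [r [sr rE]]]]]] := H _ (fU v Vv).
  have oVW := smooth_preimage_open oV oW sf.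
  exists (V `&` f @^-1` W); split=> //.
  split=> //; exists c, (r \o f); split; last by move=> w [_ /rE].
  apply: (smooth_comp oVW _ _ sr); first by move=> w [].
  by apply: smooth_sub sf => w [].
- move=> n C p H; split; first by apply: bigcup_open => U /H[].
  move=> u [U CU Uu]; have [_ /(_ u Uu)[V [Vu VU Vp]]] := H U CU.
  by exists V; split=> // w /VU Uw; exists U.
Defined.

Lemma lift_is_dvs : is_dvs lift_diffeology.
Proof.
split=> n U p.
  move=> [[oU H1] [_ H2]]; split=> // u Uu.
  have [V1 [V1u V1U [oV1 [p1 [r1 [sr1 r1E]]]]]] := H1 u Uu.
  have [V2 [V2u V2U [oV2 [p2 [r2 [sr2 r2E]]]]]] := H2 u Uu.
  have [q [f1 [f2 _]]] := filtered_common hX p1 p2.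
  have oV : open (V1 `&` V2) by exact: openI.
  exists (V1 `&` V2); split=> //; first by move=> w [/V1U].
  split=> //; exists q.
  exists (fun w => germ_diff f1 (r1 w) + germ_diff f2 (r2 w)); split.
    apply: smooth_add => //.
      apply: (@smooth_comp _ _ _ _ _ setT r1) => //.
        by apply: smooth_sub sr1 => w [].
      exact: smooth_linear_rV openT.
    apply: (@smooth_comp _ _ _ _ _ setT r2) => //.
      by apply: smooth_sub sr2 => w [].
    exact: smooth_linear_rV openT.
  move=> w [Vw1 Vw2] /=; rewrite linearD /=.
  have /= -> := r1E w Vw1; have /= -> := r2E w Vw2.
  congr (_ + _); apply/esym.
    exact: (colim_in_map (F := tangent_functor D x) f1).
  exact: (colim_in_map (F := tangent_functor D x) f2).
move=> [[oU H] [_ sa]]; split=> // u Uu.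
have [V [Vu VU [oV [c [r [sr rE]]]]]] := H u Uu.
exists V; split=> //; split=> //.
exists c, (fun w => ((snd \o p) w : R) *: r w); split.
  move=> k; apply: (@Ck_scale R _ _ k V (snd \o p) r) => //.
  exact: Ck_sub (sa k).
by move=> w Vw; rewrite linearZ /= -rE.
Qed.

Lemma lift_finer (E : diffeology R (internal_tangent D x)) :
  is_dvs E -> finer lift_diffeology E.
Proof.
move=> dE n U q [oU H]; apply: plot_local => u Uu.
have [V [Vu VU [oV [c [r [sr rE]]]]]] := H u Uu.
exists V; split=> //; apply: plot_ext (dvs_plot_linear (tangent_in c) dE oV sr).
by move=> w Vw; rewrite /= rE.
Qed.

(** Containing L and being contained in L makes E a diffeological vector space,
    since L is one, and makes it the smallest one. *)
Lemma is_fine_lift (E : diffeology R (internal_tangent D x)) :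
  finer lift_diffeology E -> finer E lift_diffeology -> is_fine_dvs E.
Proof.
move=> LE EL; split.
  split=> n U p.
    move=> [H1 H2]; apply: LE; apply: lift_is_dvs.1.
    by split; exact: EL.
  move=> [H1 H2]; apply: LE; apply: lift_is_dvs.2.
  by split=> //; exact: EL.
move=> n U p; split=> [/EL Lp|[_ H]]; last exact/LE/H/lift_is_dvs.
split; first exact: plot_open Lp.
by move=> F /lift_finer; exact.
Qed.

(** A vector r at the pointed plot c is the value of T c at (0, r), up to the
    identity germ that compares c with its translate by 0. *)
Lemma lift_finer_hector :
  finer lift_diffeology (fibre_diffeology x (hector_diffeology D)).
Proof.
move=> n U q [oU H]; apply: plot_local => u Uu.
have [V [Vu VU [oV [c [r [sr rE]]]]]] := H u Uu.
exists V; split=> //.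
pose f w : 'rV[R]_(pp_dim c + pp_dim c) := row_mx 0 (r w).
have sf : smooth_on V f by apply: smooth_row_mx => // k; exact: Ck_cst.
have fV w : V w -> tangent_dom (U := @pp_dom _ _ _ _ c) (f w).
  by move=> _; rewrite /tangent_dom /= row_mxKl; exact: pp_dom0.
apply: plot_ext (hector_tangent_map (pp_plot c) oV sf fV) => w Vw.
rewrite /= rE//.
have c0 : pp_dom (p := c) (lsubmx (f w)) by exact: fV.
have cx : pp_map (p := c) (lsubmx (f w)) = x by rewrite row_mxKl; exact: pp_map0.
rewrite (tangent_mapE _ c0 cx); congr existT; rewrite row_mxKr.
have [g gE] : exists g : germ_rep (translate_at (pp_plot c) c0 cx) c,
    germ_fun g = idfun.
  apply: (@germ_rep_near _ _ _ _ _ _ setT) => //; first exact: openT.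
    by apply: smooth_id; exact: openT.
  by move=> b _ _ _; rewrite /= row_mxKl add0r.
by rewrite -(tangent_in_germ g) gE diff_val.
Qed.

(** * Hector plots in the fibre *)

(** The moving base point is absorbed by coequalising two germs into the plot
    Q(a, b) = p (u (w0 + a) + b): after coequalisation by h, all points (a, 0)
    go to 0, so a single pointed plot represents the classes for all w near w0. *)
Lemma tangent_map_lift n (U : set 'rV[R]_n) p (pl : plot D U p) m
    (V : set 'rV[R]_m) (f : 'rV[R]_m -> 'rV[R]_(n + n))
    (s : 'rV[R]_m -> internal_tangent D x) :
  open V -> smooth_on V f -> (forall w, V w -> tangent_dom (U := U) (f w)) ->
  (forall w, V w -> tangent_map pl (f w) = existT _ x (s w)) ->
  plot lift_diffeology V s.
Proof.
move=> oV sf fU fs; split=> // w0 Vw0.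
pose u w := lsubmx (f w); pose v w := rsubmx (f w).
have su : smooth_on V u.
  by apply: (@smooth_comp _ _ _ _ _ setT f) => //; exact: smooth_linear_rV openT.
have sv : smooth_on V v.
  by apply: (@smooth_comp _ _ _ _ _ setT f) => //; exact: smooth_linear_rV openT.
have px w : V w -> p (u w) = x by move=> /fs /projT1_eq.
have pU w : V w -> U (u w) by exact: fU.
pose c := translate_at (plot_cst D x oV) Vw0 erefl.
(* The pointed plot Q is p o F based at (w0, 0). *)
pose A := [set z : 'rV[R]_(m + n) | V (lsubmx z)].
have oA : open A.
  rewrite -[A]setTI; apply: smooth_preimage_open => //; first exact: openT.
  exact: smooth_linear_rV openT.
pose F z : 'rV[R]_n := u (lsubmx z) + rsubmx z.
have sF : smooth_on A F.
  apply: smooth_add => //; last exact: smooth_linear_rV.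
  by apply: (@smooth_comp _ _ _ _ _ V (@lsubmx R 1 m n)) => //;
    exact: smooth_linear_rV.
have oB : open (A `&` F @^-1` U).
  by apply: smooth_preimage_open => //; exact: plot_open pl.
have plQ : plot D (A `&` F @^-1` U) (p \o F).
  by apply: (plot_comp pl oB) => [|z []//]; apply: smooth_sub sF => z [].
have BE w : V w -> (A `&` F @^-1` U) (row_mx w 0).
  by move=> Vw; rewrite /A /F /= row_mxKl row_mxKr addr0; split=> //; exact: pU.
have QE w : V w -> (p \o F) (row_mx w 0) = x.
  by move=> Vw; rewrite /F /= row_mxKl row_mxKr addr0; exact: px.
pose Q := translate_at plQ (BE _ Vw0) (QE _ Vw0).
(* Both germs below are compatible with the plots because p (u w) = x. *)
have [i iE] : exists g : germ_rep c Q, germ_fun g = (fun a => row_mx a 0).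
  apply: (@germ_rep_near _ _ _ _ _ _ setT) => //; first exact: openT.
  - apply: smooth_row_mx; first exact: openT.
      by apply: smooth_id; exact: openT.
    by move=> k; apply: Ck_cst; exact: openT.
  - exact: row_mx0.
  - move=> a _ ca _; rewrite /= add_row_mx addr0; apply/esym/QE.
    exact: (translate_at_sub ca).
have [j jE] : exists g : germ_rep c Q, germ_fun g = (fun=> 0).
  apply: (@germ_rep_near _ _ _ _ _ _ setT) => //; first exact: openT.
    by move=> k; apply: Ck_cst; exact: openT.
  by move=> a _ _ _; rewrite /= addr0; apply/esym/QE.
have [_ _ /(_ _ _ (germ_of i) (germ_of j))[e [h' hij]]] := hX.
pose h : germ_rep Q e := germ_repr h'.
have {hij} h0 : \forall a \near (0 : 'rV[R]_m), h (row_mx a 0) = 0.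
  move: hij; rewrite /= -(germ_reprK h') !germ_compE => /germ_ofP /=.
  by rewrite iE jE; apply: filterS => a ->; exact: germ_rep0.
have [W [[oW W0 WQ] [sh _ he hE]]] := germ_funP h.
have : nbhs (0 : 'rV[R]_m) [set a | h (row_mx a 0) = 0] by exact: h0.
rewrite nbhsE => -[N [oN N0] Nh].
pose g w : 'rV[R]_(m + n) := row_mx (- w0 + w) 0.
have sg : smooth_on V g.
  apply: smooth_row_mx => //; first exact: smooth_shift.
  by move=> k; exact: Ck_cst.
(* On V' the point (w - w0, 0) lies in the domain W of h and is killed by h. *)
pose V' := (V `&` g @^-1` W) `&` (fun w => - w0 + w) @^-1` N.
have oVW : open (V `&` g @^-1` W) by exact: smooth_preimage_open.
have oV' : open V' by apply: smooth_preimage_open => //; exact: smooth_shift.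
have V'V : V' `<=` V by move=> w [[]].
exists V'; split=> //.
  split; last by rewrite /= addNr.
  by split=> //=; rewrite /g addNr row_mx0.
split=> //; exists e, (fun w => 'd h (g w) (row_mx 0 (v w))); split.
  apply: (smooth_diff oV' _ sh).
  - by move=> w [[]].
  - exact: smooth_sub sg.
  - apply: smooth_row_mx => //; first by move=> k; exact: Ck_cst.
    exact: smooth_sub sv.
move=> w [[Vw Wg] Nw].
have E := @tangent_mapE _ _ _ _ _ _ _ pl (f w) (pU w Vw) (px w Vw).
rewrite (existT_inj (etrans (esym (fs w Vw)) E)) {E}.
pose G (b : 'rV[R]_n) : 'rV[R]_(m + n) := row_mx (- w0 + w) b.
have sG O : open O -> smooth_on O G.
  move=> oO; apply: smooth_row_mx => //; last exact: smooth_id.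
  by move=> k; exact: Ck_cst.
have oGW : open (setT `&` G @^-1` W).
  by apply: smooth_preimage_open => //; [exact: openT|exact: sG openT].
pose P := translate_at pl (pU w Vw) (px w Vw).
(* Since h kills (w - w0, 0), the slice of h there is a germ at 0. *)
have [k kE] : exists k : germ_rep P e, germ_fun k = h \o G.
  apply: (@germ_rep_near _ _ _ _ P e (setT `&` G @^-1` W)) => //.
  - apply: (smooth_comp oGW _ _ sh); first by move=> b [].
    exact: sG.
  - exact: Nh.
  - move=> b [_ Wb] _ _; rewrite -[RHS](hE _ Wb) /=.
    by rewrite add_row_mx addrA subrr add0r /F add0r row_mxKl row_mxKr.
rewrite -(tangent_in_germ k) kE.
have dG : differentiable G 0 by have [+ _] := sG setT openT 1%N; apply.
have dh : differentiable h (G 0) by have [+ _] := sh 1%N; apply.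
congr (tangent_in _ _); rewrite (diff_comp dG dh) /=.
by congr ('d h _ _); rewrite diff_row_mx.
Qed.

(** * Passing to the whole tangent bundle *)

Let B := tangent_bundle D.
Let at_x (t : internal_tangent D x) : B := existT _ x t.

(** A plot of TX need not restrict to a plot of the fibre over x, as the
    preimage of x need not be open.  Testing on smooth maps f whose image stays
    over x avoids the restriction. *)
Definition fibre_test_plot n (U : set 'rV[R]_n) (q : 'rV[R]_n -> B) : Prop :=
  plot D U (fun w => projT1 (q w)) /\
  forall m (V : set 'rV[R]_m) (f : 'rV[R]_m -> 'rV[R]_n)
      (s : 'rV[R]_m -> internal_tangent D x),
    open V -> smooth_on V f -> (forall v, V v -> U (f v)) ->
    (forall v, V v -> q (f v) = at_x (s v)) -> plot lift_diffeology V s.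

Definition fibre_test_diffeology : diffeology R B.
Proof.
apply: (@Diffeology R _ fibre_test_plot).
- by move=> n U p [/plot_open].
- move=> n U p q pq [Dp H]; split.
    by apply: plot_ext Dp => u Uu; rewrite pq.
  move=> m V f s oV sf fU qE; apply: (H m V f s) => // v Vv.
  by rewrite pq ?qE//; exact: fU.
- move=> n U b oU; split; first exact: plot_cst.
  move=> m V f s oV sf fU bE.
  apply: plot_local => v Vv; exists V; split=> //.
  apply: plot_ext (plot_cst lift_diffeology (s v) oV) => w Vw.
  by apply: (existT_inj (T := internal_tangent D)); rewrite -[LHS]bE// -[RHS]bE.
- move=> m n U V p f [Dp H] oV sf fU; split; first exact: plot_comp Dp _ _ _.
  move=> k W g s oW sg gV; apply: (H k W (f \o g) s) => //.
    exact: smooth_comp sf.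
  by move=> w /gV/fU.
- move=> n C p H; split; first by apply: plot_cover => U /H[].
  move=> m V f s oV sf fU pE; apply: plot_local => v Vv.
  have [U CU Uf] := fU v Vv; have [Dp {}H] := H U CU.
  have oW := smooth_preimage_open oV (plot_open Dp) sf.
  exists (V `&` f @^-1` U); split=> //.
  apply: (H _ _ f) => //; first by apply: smooth_sub sf => w [].
    by move=> w [].
  by move=> w [Vw _]; exact: pE.
Defined.

Lemma hector_finer_fibre_test :
  finer (hector_diffeology D) fibre_test_diffeology.
Proof.
move=> n0 U0 q0 [_]; apply=> n U p pl m W f oW sf fW; split.
  apply: (@plot_comp _ _ D m n U W p (lsubmx \o f) pl oW) fW.
  exact: (@smooth_comp _ _ _ _ _ setT _ _ oW _ sf (smooth_lsubmx openT)).
move=> k V g s oV sg gW sE.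
apply: (@tangent_map_lift _ _ _ pl _ _ (f \o g)) => //.
  exact: smooth_comp sf.
by move=> v /gW/fW.
Qed.

(** Over x the fibrewise operations are those of T_x(X), under which L is
    stable; elsewhere the test is void. *)
Lemma fibre_test_is_dvs_over :
  is_dvs_over (T := internal_tangent D) D fibre_test_diffeology.
Proof.
split.
- by move=> n U p [].
- move=> n U p [[Dp H1] [_ H2]]; split=> //.
  move=> m V f s oV sf fU sE.
  have /choice[st stE] v :
      exists st : internal_tangent D x * internal_tangent D x,
      V v -> fibre_pair (p (f v)) = (at_x st.1, at_x st.2) /\ s v = st.1 + st.2.
    have [Vv|nVv] := pselect (V v); last by exists (0, 0).
    by have [a [b ab]] := fibre_add_inv (sE v Vv); exists (a, b).
  apply: (@plot_ext _ _ _ _ _ (fun v => (st v).1 + (st v).2)).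
    by move=> v /stE[_ ->].
  apply: (lift_is_dvs.1 _ V st); split.
    by apply: (H1 m V f) => // v /stE[/(congr1 fst)].
  by apply: (H2 m V f) => // v /stE[/(congr1 snd)].
- move=> n U p [[Dp H1] [oU H2]]; split=> //.
  move=> m V f s oV sf fU sE.
  have /choice[t tE] v : exists t : internal_tangent D x,
      V v -> (p (f v)).1 = at_x t /\ s v = ((p (f v)).2 : R) *: t.
    have [Vv|nVv] := pselect (V v); last by exists 0.
    by have [t tE] := fibre_scale_inv (sE v Vv); exists t.
  apply: (@plot_ext _ _ _ _ _ (fun v => ((p (f v)).2 : R) *: t v)).
    by move=> v /tE[_ ->].
  apply: (lift_is_dvs.2 _ V (fun v => (t v, (p (f v)).2))); split.
    by apply: (H1 m V f) => // v /tE[].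
  by split=> //; exact: (smooth_comp oV fU sf H2).
Qed.

Lemma dvs_finer_lift :
  finer (fibre_diffeology x (dvs_diffeology D)) lift_diffeology.
Proof.
move=> n U q [oU /(_ _ (conj hector_finer_fibre_test fibre_test_is_dvs_over))[_ H]].
by apply: (H n U idfun) => //; exact: smooth_id.
Qed.

End FilteredFibre.

Theorem theorem4p16 (R : realType) (X : Type) (D : diffeology R X) (x : X)
    (hX : filtered (germ_category D x)) :
  is_fine_dvs (fibre_diffeology x (hector_diffeology D)) /\
  is_fine_dvs (fibre_diffeology x (dvs_diffeology D)).
Proof.
have hector_dvs : finer (fibre_diffeology x (hector_diffeology D))
    (fibre_diffeology x (dvs_diffeology D)).
  by move=> n U q; exact: (dvs_diffeologyP D).1.
have lift_hector := @lift_finer_hector _ _ _ _ hX.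
have dvs_lift := @dvs_finer_lift _ _ _ _ hX.
split; apply: (@is_fine_lift _ _ _ _ hX) => n U q.
- exact: lift_hector.
- by move=> /hector_dvs /dvs_lift.
- by move=> /lift_hector /hector_dvs.
- exact: dvs_lift.
Qed.
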